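(* Let $V$ be a finite set, $v_0\notin V$, $d\geq 0$ an integer, and let $\mathscr{O}$ be an oriented matroid on the set of elements $V\sqcup\{v_0\}$ of rank at most $d$. Suppose that $r\geq d$ and that $U_1,\ldots,U_r\subseteq V$ are pairwise disjoint nonempty subsets of $V$ such that $v_0\in\operatorname{conv}(U_1)\cap\cdots\cap\operatorname{conv}(U_r)$. Then there exist $u_1\in U_1,\ldots,u_r\in U_r$ such that $v_0\in\operatorname{conv}(\{u_1,\ldots,u_r\})$.
   Context: Let $E$ be a finite set. A sign vector on $E$ is a function $\Phi\colon E\to\{-,0,+\}$; write $\Phi^{+}=\Phi^{-1}(+)$, $\Phi^{-}=\Phi^{-1}(-)$, $0$ for the all-zero sign vector, $-\Phi$ for the coordinatewise negation, $(\Phi\circ\Psi)(e)=\Phi(e)$ if $\Phi(e)\ne0$ and $\Psi(e)$ otherwise, and $S(\Phi,\Psi)=(\Phi^+\cap\Psi^-)\cup(\Phi^-\cap\Psi^+)$. An oriented matroid $\mathscr{O}$ on the set of elements $E$ is given by a set $\mathscr{L}(\mathscr{O})$ of sign vectors on $E$ (its covectors) such that: $0\in\mathscr{L}(\mathscr{O})$; $-\Phi\in\mathscr{L}(\mathscr{O})$ iff $\Phi\in\mathscr{L}(\mathscr{O})$; $\Phi\circ\Psi\in\mathscr{L}(\mathscr{O})$ for all $\Phi,\Psi\in\mathscr{L}(\mathscr{O})$; and for all $\Pi,\Xi\in\mathscr{L}(\mathscr{O})$ and $v\in\Pi^+\cap\Xi^-$ there is $\Theta\in\mathscr{L}(\mathscr{O})$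 with $\Theta(v)=0$ and $\Theta(w)=(\Pi\circ\Xi)(w)$ for all $w\in E-S(\Pi,\Xi)$. Two sign vectors $\Phi,\Psi$ are orthogonal if: there is $v$ with $\Phi(v)=\Psi(v)\neq0$ if and only if there is $w$ with $\Phi(w)=-\Psi(w)\neq0$. A vector of $\mathscr{O}$ is a sign vector orthogonal to every covector; $\mathscr{V}(\mathscr{O})$ is the set of vectors. The rank of $\mathscr{O}$ is the usual one: the maximal $k$ for which there is a chain $0<\Phi_1<\dots<\Phi_k$ in $\mathscr{L}(\mathscr{O})$ for the coordinatewise order induced by $0<-$, $0<+$ (with $-,+$ incomparable). For $U\subseteq E$, $\operatorname{conv}(U):=U\cup\{v\in E-U:\ \Phi^+\subseteq U\text{ and }\Phi^-=\{v\}\text{ for some }\Phi\in\mathscr{V}(\mathscr{O})\}$. *)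

(* Defs.v *)
From HB Require Import structures.
From mathcomp Require Import all_boot.

Set Implicit Arguments.
Unset Strict Implicit.
Unset Printing Implicit Defensive.

Inductive sign := Neg | Zero | Pos.

Definition bool_of_sign (s : sign) : option bool :=
  match s with Neg => Some false | Zero => None | Pos => Some true end.

Definition sign_of_bool (b : option bool) : sign :=
  match b with Some false => Neg | None => Zero | Some true => Pos end.

Lemma bool_of_signK : cancel bool_of_sign sign_of_bool.
Proof. by case. Qed.

HB.instance Definition _ := Finite.copy sign (can_type bool_of_signK).

Definition sign_opp (s : sign) : sign :=
  match s with Neg => Pos | Zero => Zero | Pos => Neg end.

Notation signvec E := {ffun E -> sign}.

Section SignVectors.

Variable E : finType.
Implicit Types Phi Psi : signvec E.

Definition sv_pos Phi : {set E} := [set e | Phi e == Pos].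

Definition sv_neg Phi : {set E} := [set e | Phi e == Neg].

Definition sv0 : signvec E := [ffun=> Zero].

Definition sv_opp Phi : signvec E := [ffun e => sign_opp (Phi e)].

Definition sv_comp Phi Psi : signvec E :=
  [ffun e => if Phi e != Zero then Phi e else Psi e].

Definition sv_sep Phi Psi : {set E} :=
  (sv_pos Phi :&: sv_neg Psi) :|: (sv_neg Phi :&: sv_pos Psi).

Definition sv_orthogonal Phi Psi : bool :=
  [exists v, (Phi v == Psi v) && (Phi v != Zero)]
    == [exists w, (Phi w == sign_opp (Psi w)) && (Phi w != Zero)].

Definition sign_le (s t : sign) : bool := (s == Zero) || (s == t).

Definition sv_le Phi Psi : bool := [forall e, sign_le (Phi e) (Psi e)].

Definition sv_lt Phi Psi : bool := (Phi != Psi) && sv_le Phi Psi.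

End SignVectors.

Arguments sv0 {E}.

Record orientedMatroid (E : finType) := OrientedMatroid {
  covectors : {set signvec E};
  covectors0 : sv0 \in covectors;
  covectorsN : forall Phi, (sv_opp Phi \in covectors) = (Phi \in covectors);
  covectors_comp : forall Phi Psi,
    Phi \in covectors -> Psi \in covectors -> sv_comp Phi Psi \in covectors;
  covectors_elim : forall Pi Xi v,
    Pi \in covectors -> Xi \in covectors -> v \in sv_pos Pi :&: sv_neg Xi ->
    exists Theta, [/\ Theta \in covectors, Theta v = Zero &
      forall w, w \notin sv_sep Pi Xi -> Theta w = sv_comp Pi Xi w]
}.

Section OrientedMatroids.

Variables (E : finType) (O : orientedMatroid E).

Definition vectors : {set signvec E} :=
  [set Phi | [forall Psi in covectors O, sv_orthogonal Phi Psi]].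

Definition om_chain (s : seq (signvec E)) : bool :=
  all (mem (covectors O)) s && path (@sv_lt E) sv0 s.

(* A chain of length k, together with 0, consists of k + 1 distinct covectors,
   so the bound on k below loses nothing; see [om_rank_max]. *)
Definition om_rank : nat :=
  \max_(k < #|covectors O| | [exists s : k.-tuple (signvec E), om_chain s]) k.

Definition conv (U : {set E}) : {set E} :=
  U :|: [set v in ~: U |
          [exists Phi in vectors, (sv_pos Phi \subset U)
                                  && (sv_neg Phi == [set v])]].

Lemma sv_lt_irr : irreflexive (@sv_lt E).
Proof. by move=> x; rewrite /sv_lt eqxx. Qed.

Lemma sv_lt_trans : transitive (@sv_lt E).
Proof.
move=> y x z /andP[nxy /forallP xy] /andP[nyz /forallP yz]; apply/andP; split.
  apply: contraNneq nxy => exz; apply/eqP/ffunP => e.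
  move: (xy e) (yz e); rewrite -exz /sign_le.
  by case/orP=> /eqP ->; [case/orP=> /eqP -> | ].
apply/forallP=> e; move: (xy e) (yz e); rewrite /sign_le.
by case/orP=> /eqP ->; rewrite ?eqxx.
Qed.

Lemma om_chain_size s : om_chain s -> size s < #|covectors O|.
Proof.
case/andP=> /allP sL ps.
have us : uniq (sv0 :: s).
  exact: (sorted_uniq sv_lt_trans sv_lt_irr (ps : sorted _ (sv0 :: s))).
rewrite -[(size s).+1]/(size (sv0 :: s)) -(card_uniqP us).
apply/subset_leq_card/subsetP=> x; rewrite inE => /predU1P[->|/sL //].
exact: covectors0.
Qed.

Lemma om_rank_max s : om_chain s -> size s <= om_rank.
Proof.
move=> cs; have lt_s := om_chain_size cs.
apply: (@leq_bigmax_cond _ _ _ (Ordinal lt_s)) => /=.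
by apply/existsP; exists (in_tuple s).
Qed.

Lemma om_rank_attained : exists2 s, om_chain s & size s = om_rank.
Proof.
rewrite /om_rank; elim/big_ind: _ => [|m n [s cs <-] [t ct <-]|k].
- by exists [::].
- by rewrite /maxn; case: ifP => _; [exists t | exists s].
- by case/existsP=> s cs; exists s; rewrite ?size_tuple.
Qed.

End OrientedMatroids.

(* Main.v *)
From HB Require Import structures.
Require Import Defs.
From mathcomp Require Import all_boot ssralg.

(** For u in V let H_u be the closed half-space formed by the covectors that are
    positive at v0 and not positive at u. By the Farkas lemma, v0 lies outside
    conv(A) exactly when the half-spaces H_u, u in A, have a covector in common;
    such a set A is called feasible ([conv_feasible]). Feasible sets form a
    simplicial complex X on V, the nerve of the H_u, and the theorem becomes a
    colourful Helly theorem: if every rainbow set is feasible, then so is one of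
    the colour classes U_i. This is proved with chains modulo 2.

    The geometric input is [feasible_fillable]: inside any ground set, a cycle of
    X made of m-element sets, with m at least the rank, is a boundary. Fix u in
    the ground set. A set that is feasible on both closed sides of the
    hyperplane of u is feasible on the hyperplane, by covector elimination, and
    the hyperplane is the contraction at u, of smaller rank. Mayer-Vietoris for
    the two sides then shows, by induction, that the link of u in X has no
    homology in the relevant degrees, so every cycle can be pushed off u.

    The combinatorial part holds for any complex X with such fillings
    ([colourful_simplex]). Suppose that rainbow sets are in X and colour classes
    are not. Let A range over the sets with at least two elements of every
    colour. When A has exactly two of each, the rainbow subsets of A are the
    facets of a cross-polytope, a sphere, and c_A is a chain of X inside A that
    fills it; for larger A, the chain c_A fills the sum of the c_(A - e). All
    these chains exist because the cycles to be filled have sets of size at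
    least the number of colours ([system_exists]). Now take a colour class U. As
    no set of X contains U, the slices of the c_A along a flag of subsets of U
    add up to a system of the same kind for the remaining colours
    ([system_eliminate]). When no colour is left, the system would fill the
    empty cross-polytope, the chain consisting of the empty set, inside the
    empty ground set, which is impossible ([no_system0]). *)

Set Implicit Arguments.
Unset Strict Implicit.
Unset Printing Implicit Defensive.

Import GRing.Theory.

(** * Sign vectors, contraction and the Farkas lemma *)

Section SignVectorFacts.

Variable E : finType.
Implicit Types (Phi Psi : signvec E) (e : E).

Lemma sign_oppK : involutive sign_opp. Proof. by case. Qed.

Definition agrees Phi Psi := [exists e, (Phi e == Psi e) && (Phi e != Zero)].

Definition opposes Phi Psi :=
  [exists e, (Phi e == sign_opp (Psi e)) && (Phi e != Zero)].

Lemma sv_orthogonalE Phi Psi :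
  sv_orthogonal Phi Psi = (agrees Phi Psi == opposes Phi Psi).
Proof. by []. Qed.

Lemma agrees_oppr Phi Psi : agrees Phi (sv_opp Psi) = opposes Phi Psi.
Proof. by apply: eq_existsb => e; rewrite ffunE. Qed.

Lemma opposes_oppr Phi Psi : opposes Phi (sv_opp Psi) = agrees Phi Psi.
Proof. by apply: eq_existsb => e; rewrite ffunE sign_oppK. Qed.

Lemma agrees_oppl Phi Psi : agrees (sv_opp Phi) Psi = opposes Phi Psi.
Proof.
by apply: eq_existsb => e; rewrite ffunE; case: (Phi e) (Psi e) => [] [].
Qed.

Lemma opposes_oppl Phi Psi : opposes (sv_opp Phi) Psi = agrees Phi Psi.
Proof.
by apply: eq_existsb => e; rewrite ffunE; case: (Phi e) (Psi e) => [] [].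
Qed.

End SignVectorFacts.

Section Contraction.

Variables (E : finType) (O : orientedMatroid E) (a : E).

Definition contract_covectors :=
  [set Psi in covectors O | Psi a == Zero].

Lemma contract_covectors0 : sv0 \in contract_covectors.
Proof. by rewrite inE covectors0 ffunE. Qed.

Lemma contract_covectorsN Phi :
  (sv_opp Phi \in contract_covectors) = (Phi \in contract_covectors).
Proof. by rewrite !inE covectorsN ffunE; case: (Phi a). Qed.

Lemma contract_covectors_comp Phi Psi :
  Phi \in contract_covectors -> Psi \in contract_covectors ->
  sv_comp Phi Psi \in contract_covectors.
Proof.
rewrite !inE => /andP[OPhi Phia] /andP[OPsi Psia].
by rewrite covectors_comp // ffunE Phia.
Qed.

Lemma contract_covectors_elim Pi Xi v :
  Pi \in contract_covectors -> Xi \in contract_covectors ->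
  v \in sv_pos Pi :&: sv_neg Xi ->
  exists Theta, [/\ Theta \in contract_covectors, Theta v = Zero &
    forall w, w \notin sv_sep Pi Xi -> Theta w = sv_comp Pi Xi w].
Proof.
rewrite !inE => /andP[OPi /eqP Pia] /andP[OXi /eqP Xia] vPX.
have [|Theta [OTheta Theta_v ThetaE]] := covectors_elim (v := v) OPi OXi.
  by rewrite !inE.
exists Theta; split=> //; rewrite inE OTheta ThetaE ?ffunE ?Pia ?Xia //.
by rewrite !inE Pia Xia.
Qed.

(** The ground set is kept: the contracted element stays behind as a loop, so
    that contractions can be iterated without changing the ambient type. *)
Definition contract : orientedMatroid E :=
  OrientedMatroid contract_covectors0 contract_covectorsN
    contract_covectors_comp contract_covectors_elim.

Lemma in_contract Psi :
  (Psi \in covectors contract) = (Psi \in covectors O) && (Psi a == Zero).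
Proof. by rewrite inE. Qed.

(** A maximal chain of the contraction is prolonged by composing its top with a
    covector that does not vanish at [a]. *)
Lemma om_rank_contract Psi :
  Psi \in covectors O -> Psi a != Zero -> om_rank contract < om_rank O.
Proof.
move=> OPsi Psia; have [s /andP[/allP sL ps] <-] := om_rank_attained contract.
pose t := last sv0 s.
have : t \in covectors contract.
  have := mem_last sv0 s; rewrite -/t inE => /predU1P[->|/sL //].
  exact: covectors0.
rewrite in_contract => /andP[Ot /eqP ta].
rewrite -(size_rcons s (sv_comp t Psi)); apply: om_rank_max.
apply/andP; split.
  rewrite all_rcons /= covectors_comp //=; apply/allP=> Phi /sL /=.
  by rewrite in_contract => /andP[].
rewrite rcons_path ps /= -/t; apply/andP; split.
  apply/eqP=> /(congr1 (fun Phi : signvec E => Phi a)).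
  by rewrite !ffunE ta /=; apply/eqP; rewrite eq_sym.
by apply/forallP=> e; rewrite ffunE /sign_le; case: (t e).
Qed.

End Contraction.

Section Farkas.

Variable E : finType.
Implicit Types (O : orientedMatroid E) (Phi Psi : signvec E) (e a : E).

(** Eliminating [a] between [Psi1] and the opposite of [Psi2] produces a
    covector of the contraction that is conformal to [Phi] without vanishing on
    all of its support, so it is not orthogonal to [Phi]. *)
Lemma orthogonal_contract_conflict O a Phi Psi1 Psi2 :
  (forall Psi, Psi \in covectors O -> Psi a = Zero ->
     agrees Phi Psi = opposes Phi Psi) ->
  Phi a = Zero ->
  Psi1 \in covectors O -> Psi1 a = Pos ->
  Psi2 \in covectors O -> Psi2 a = Pos ->
  agrees Phi Psi1 -> ~~ opposes Phi Psi1 -> agrees Phi Psi2.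
Proof.
move=> Phi_orth Phia O1 a1 O2 a2 ag1 nop1; apply: contraTT ag1 => nag2.
rewrite -covectorsN in O2.
have [|T [OT Ta TE]] := covectors_elim (v := a) O1 O2.
  by rewrite !inE a1 ffunE a2.
move: nop1 nag2; rewrite !negb_exists => /forallP nop1 /forallP nag2.
have TP e : Phi e != Zero -> T e = Zero \/ T e = Phi e.
  move=> Pe; move: (nop1 e) (nag2 e) (TE e).
  rewrite Pe !inE !ffunE.
  by case: (Phi e) Pe (Psi1 e) (Psi2 e) => [] // _ [] [] //= _ _ ->; auto.
have nopT : opposes Phi T = false.
  apply/existsP=> -[e /andP[/eqP PT Pe]].
  by move: PT; have [->|->] := TP e Pe; case: (Phi e) Pe.
have := Phi_orth T OT Ta; rewrite nopT => /negbT.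
rewrite negb_exists => /forallP nagT.
apply/forallP=> e; apply/negP=> /andP[/eqP Pe nz].
move: (nop1 e) (nag2 e) (nagT e) (TE e).
rewrite nz !inE !ffunE -Pe.
by case: (Phi e) nz (Psi2 e) => [] // _ [] //= _ _ /[swap] ->.
Qed.

Definition sv_set Phi a s : signvec E :=
  [ffun x => if x == a then s else Phi x].

Lemma agrees_set Phi a s Psi : Phi a = Zero ->
  agrees (sv_set Phi a s) Psi = agrees Phi Psi || (s == Psi a) && (s != Zero).
Proof.
move=> Phia; apply/existsP/orP => [[e]|[/existsP[e He]|Ha]].
- rewrite ffunE; have [->|_] := eqVneq e a => He; [by right | left].
  by apply/existsP; exists e.
- exists e; rewrite ffunE; have [ea|//] := eqVneq e a.
  by rewrite ea Phia eqxx andbF in He.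
- by exists a; rewrite ffunE eqxx.
Qed.

Lemma opposes_set Phi a s Psi : Phi a = Zero ->
  opposes (sv_set Phi a s) Psi
    = opposes Phi Psi || (s == sign_opp (Psi a)) && (s != Zero).
Proof. by move=> Phia; rewrite -!agrees_oppr agrees_set // ffunE. Qed.

(** Normalising covectors to be positive at [a], each of them forbids at most
    two of the three signs at [a]; two covectors with no common admissible sign
    would contradict orthogonality in the contraction. *)
Lemma vectors_contract_lift O a Phi :
  Phi \in vectors (contract O a) -> Phi a = Zero ->
  exists s, sv_set Phi a s \in vectors O.
Proof.
rewrite inE => /forall_inP Phi_orth Phia.
have {}Phi_orth Psi : Psi \in covectors O -> Psi a = Zero ->
    agrees Phi Psi = opposes Phi Psi.
  move=> OPsi Psia; apply/(@eqP bool); apply: Phi_orth.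
  by rewrite in_contract OPsi Psia.
have opp_orth Psi : Psi \in covectors O -> Psi a = Zero ->
    agrees (sv_opp Phi) Psi = opposes (sv_opp Phi) Psi.
  by move=> OPsi Psia; rewrite agrees_oppl opposes_oppl Phi_orth.
have oppa : sv_opp Phi a = Zero by rewrite ffunE Phia.
suff [s Hs] : exists s, forall Psi, Psi \in covectors O -> Psi a = Pos ->
    agrees Phi Psi || (s == Pos) = opposes Phi Psi || (s == Neg).
  exists s; rewrite inE; apply/forall_inP=> Psi OPsi.
  rewrite sv_orthogonalE agrees_set // opposes_set //.
  case Psia: (Psi a).
  - have := Hs (sv_opp Psi).
    rewrite covectorsN ffunE Psia agrees_oppr opposes_oppr.
    move=> /(_ OPsi erefl); case: s {Hs} => /=; rewrite ?orbF ?orbT => ->;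
      by rewrite ?orbT ?orbF.
  - by case: s {Hs} => /=; rewrite !orbF Phi_orth.
  have := Hs Psi OPsi Psia; case: s {Hs} => /=; rewrite ?orbF ?orbT => ->;
    by rewrite ?orbT ?orbF.
have [/exists_inP[P1 O1 /and3P[/eqP a1 ag nop]]|noP] :=
  boolP [exists Psi in covectors O,
          [&& Psi a == Pos, agrees Phi Psi & ~~ opposes Phi Psi]].
  exists Neg => Psi OPsi Psia; rewrite orbF orbT.
  exact: (orthogonal_contract_conflict Phi_orth Phia O1 a1 OPsi Psia ag nop).
have [/exists_inP[P1 O1 /and3P[/eqP a1 nag op]]|noN] :=
  boolP [exists Psi in covectors O,
          [&& Psi a == Pos, ~~ agrees Phi Psi & opposes Phi Psi]].
  exists Pos => Psi OPsi Psia; rewrite orbT orbF -agrees_oppl.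
  rewrite (orthogonal_contract_conflict opp_orth oppa O1 a1 OPsi Psia) //.
    by rewrite agrees_oppl.
  by rewrite opposes_oppl.
exists Zero => Psi OPsi Psia; rewrite !orbF.
move: noP noN; rewrite !negb_exists => /forallP/(_ Psi) + /forallP/(_ Psi).
by rewrite OPsi Psia eqxx /=; case: (agrees _ _); case: (opposes _ _).
Qed.

(** The induction removes an element [a] of [A] in two ways. An alternative
    covector of the contraction at [a] is one of [O]. Otherwise a vector of the
    contraction lifts to [O] with some sign at [a]; if that sign is negative,
    orthogonality excludes a covector that violates the constraint at [a] alone,
    so the instance with [a] deleted already yields the required vector. *)
Lemma farkas O e (A : {set E}) : e \notin A ->
  (exists2 Psi, Psi \in covectors O &
     Psi e = Pos /\ {in A, forall x, Psi x != Pos})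
  \/ (exists2 Phi, Phi \in vectors O &
     [/\ Phi e = Neg, {in A, forall x, Phi x != Neg} &
         forall x, x \notin e |: A -> Phi x = Zero]).
Proof.
elim: {A}_.+1 {-2}A (ltnSn #|A|) O => // n IH A leAn O eA.
have [->|[a aA]] := set_0Vmem A.
  have [/exists_inP[Psi OPsi /eqP Psie]|noPsi] :=
    boolP [exists Psi in covectors O, Psi e == Pos].
    by left; exists Psi; rewrite ?Psie //; split=> // x; rewrite inE.
  right; exists (sv_set sv0 e Neg); last first.
    split=> [|x|x]; rewrite ?inE // ffunE ?eqxx // orbF => /negPf->.
    by rewrite ffunE.
  rewrite inE; apply/forall_inP=> Psi OPsi.
  have Psie : Psi e = Zero.
    move: noPsi; rewrite negb_exists => /forallP noPsi.
    move: (noPsi Psi) (noPsi (sv_opp Psi)); rewrite covectorsN OPsi ffunE.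
    by case: (Psi e).
  have e0 : (sv0 : signvec E) e = Zero by rewrite ffunE.
  rewrite sv_orthogonalE agrees_set // opposes_set // Psie !orbF.
  by rewrite /agrees /opposes; apply/eqP/eq_existsb=> x; rewrite !ffunE !andbF.
have ltA : #|A :\ a| < n by move: leAn; rewrite (cardsD1 a A) aA.
have eA' : e \notin A :\ a by rewrite inE (negPf eA) andbF.
have ea : (e == a) = false by apply: contraNF eA => /eqP->.
have extA (Psi : signvec E) : Psi a != Pos ->
    {in A :\ a, forall x, Psi x != Pos} -> {in A, forall x, Psi x != Pos}.
  move=> Psia HPsi x xA; have [->//|xa] := eqVneq x a.
  by apply: HPsi; rewrite !inE xa.
have [[Psi OPsi [Psie PsiA]]|[Phi OPhi [Phie PhiA Phi0]]] :=
    IH _ ltA (contract O a) eA'.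
  move: OPsi; rewrite in_contract => /andP[OPsi /eqP Psia].
  by left; exists Psi => //; split=> //; apply: extA; rewrite ?Psia.
have Phia : Phi a = Zero by apply: Phi0; rewrite !inE eqxx eq_sym ea.
have [s Os] := vectors_contract_lift OPhi Phia.
have good : s != Neg ->
    exists2 Phi, Phi \in vectors O &
     [/\ Phi e = Neg, {in A, forall x, Phi x != Neg} &
         forall x, x \notin e |: A -> Phi x = Zero].
  move=> sN; exists (sv_set Phi a s) => //; split=> [|x xA|x].
  - by rewrite ffunE ea.
  - by rewrite ffunE; have [//|xa] := eqVneq x a; apply: PhiA; rewrite !inE xa.
  rewrite !inE negb_or => /andP[xe xA]; rewrite ffunE.
  have [xa|_] := eqVneq x a; first by rewrite xa aA in xA.
  by apply: Phi0; rewrite !inE negb_or xe negb_and xA orbT.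
have [sN|/good] := eqVneq s Neg; last by right.
have [[Psi OPsi [Psie PsiA]]|[Phi' OPhi' [Phie' PhiA' Phi0']]] :=
    IH _ ltA O eA'; last first.
  right; exists Phi' => //; split=> // x xA.
    have [->|xa] := eqVneq x a; last by apply: PhiA'; rewrite !inE xa.
    by rewrite Phi0' // !inE eqxx eq_sym ea.
  apply: Phi0'; apply: contraNN xA; rewrite !inE => /orP[->//|/andP[_ ->]].
  by rewrite orbT.
have [Psia|] := eqVneq (Psi a) Pos; last first.
  by left; exists Psi => //; split=> //; apply: extA.
(* At this point the lifted vector opposes the covector at e and at a, and
   agrees with it nowhere on A. *)
move: Os; rewrite inE => /forall_inP/(_ Psi OPsi).
rewrite sv_orthogonalE agrees_set // opposes_set // sN Psia /= orbF orbT.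
rewrite eqb_id => /existsP[x /andP[/eqP PP Px]]; exfalso.
have [xe|xe] := eqVneq x e; first by rewrite xe Phie Psie in PP.
have xA : x \in A :\ a.
  apply: contraNT Px => xA; rewrite Phi0 // !inE negb_or xe.
  by move: xA; rewrite !inE.
by move: (PhiA x xA) (PsiA x xA) Px; rewrite -PP; case: (Phi x).
Qed.

End Farkas.

(** * Chains modulo 2 on a finite set *)

Section Chains.

Local Open Scope ring_scope.

Variable V : finType.
Implicit Types (A T sigma tau : {set V}) (u x : V) (P Q : pred {set V}).

(** A chain modulo 2 is the indicator of a family of sets, and [bool] is the
    field with two elements. Degrees are cardinalities of sets, one more than
    dimensions, so that the empty set is the cell of the augmentation. *)
Definition chain : predArgType := {ffun {set V} -> bool}.

Implicit Types (z w y : chain).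

HB.instance Definition _ := GRing.Zmodule.on chain.

Lemma chainD y z sigma : (y + z) sigma = y sigma (+) z sigma.
Proof. by rewrite ffunE. Qed.

Lemma chain0 sigma : (0 : chain) sigma = false.
Proof. by rewrite ffunE. Qed.

Lemma chain_sum (I : finType) (p : pred I) (F : I -> chain) sigma :
  (\sum_(i | p i) F i) sigma = \sum_(i | p i) F i sigma.
Proof. by elim/big_rec2: _ => [|i b z _ <-]; rewrite ?chain0 ?chainD. Qed.

Lemma boolDD (b : bool) : b + b = 0.
Proof. by case: b. Qed.

Lemma chainDD z : z + z = 0.
Proof. by apply/ffunP=> sigma; rewrite chainD chain0 addbb. Qed.

Lemma chainDK y z : z + (z + y) = y.
Proof. by rewrite addrA chainDD add0r. Qed.

Lemma sum_bool_odd (I : finType) (p F : pred I) :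
  (\sum_(i | p i) (F i : bool)) = odd #|[set i | p i && F i]|.
Proof.
rewrite cardsE -sum1_card (eq_bigl (fun i => p i && F i)) ?big_mkcondr //.
elim/big_rec2: _ => // i b y _ ->.
by case: (F i).
Qed.

(** In characteristic 2 the terms at (x, x') and at (x', x) cancel; this is the
    common source of all the identities saying that a double boundary is 0. *)
Lemma sum_sym_eq0 (W : zmodType) (f : V -> V -> W) (p : pred V) :
  (forall w : W, w + w = 0) ->
  (forall x x', f x x' = f x' x) ->
  \sum_(x | p x) \sum_(x' | p x' && (x' != x)) f x x' = 0.
Proof.
move=> W2 fC; rewrite pair_big_dep /=.
rewrite (bigID (fun q => enum_rank q.1 < enum_rank q.2)%N) /=.
pose swap (q : V * V) := (q.2, q.1).
rewrite [X in _ + X](reindex_onto swap swap) /=; last by case.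
rewrite [X in _ + X](eq_big (fun q => [&& p q.1, p q.2 & q.2 != q.1]
    && (enum_rank q.1 < enum_rank q.2)%N) (fun q => f q.1 q.2)) ?W2 //.
move=> [x y] /=; rewrite eqxx andbT -leqNgt leq_eqVlt.
rewrite [y == x]eq_sym; have [<-|xy] := eqVneq x y; first by rewrite !andbF.
rewrite !andbT [p y && _]andbC; congr (_ && _).
by rewrite (inj_eq val_inj) (inj_eq enum_rank_inj) (negPf xy).
Qed.

Definition bd z : chain :=
  [ffun tau : {set V} => \sum_(x | x \notin tau) z (x |: tau)].

Lemma bdE z tau : bd z tau = \sum_(x | x \notin tau) z (x |: tau).
Proof. by rewrite ffunE. Qed.

Lemma bdD y z : bd (y + z) = bd y + bd z.
Proof.
apply/ffunP=> tau; rewrite chainD !bdE -big_split /=.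
by apply: eq_bigr => x _; rewrite chainD.
Qed.

Lemma bd0 : bd 0 = 0.
Proof. by apply: (addrI (bd 0)); rewrite -bdD !addr0. Qed.

Lemma bd_sum (I : finType) (p : pred I) (F : I -> chain) :
  bd (\sum_(i | p i) F i) = \sum_(i | p i) bd (F i).
Proof. by elim/big_rec2: _ => [|i b z _ <-]; rewrite ?bd0 ?bdD. Qed.

Lemma bd_bd z : bd (bd z) = 0.
Proof.
apply/ffunP=> tau; rewrite bdE chain0.
under eq_bigr do rewrite bdE.
pose f x x' := z (x |: (x' |: tau)).
transitivity (\sum_(x | x \notin tau)
    \sum_(x' | (x' \notin tau) && (x' != x)) f x x').
  apply: eq_bigr => x _; apply: eq_big => x'.
    by rewrite !inE negb_or andbC.
  by move=> _; rewrite setUCA.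
by apply: sum_sym_eq0 boolDD _ => x x'; rewrite /f setUCA.
Qed.

(** The cone with apex [u]; terms that already contain [u] are cancelled. *)
Definition cone u z : chain :=
  [ffun sigma : {set V} => (u \in sigma) && z (sigma :\ u)].

Lemma coneE u z sigma : cone u z sigma = (u \in sigma) && z (sigma :\ u).
Proof. by rewrite ffunE. Qed.

Lemma bd_cone u z : bd (cone u z) = z + cone u (bd z).
Proof.
apply/ffunP=> tau; rewrite chainD !bdE coneE.
have [ut|ut] := boolP (u \in tau) => /=.
  rewrite bdE [X in _ = _ (+) X](bigD1 u) ?setD11 //= setD1K //.
  rewrite -[RHS]/(addb _ (addb _ _)) addKb.
  apply: eq_big => [x|x xt].
    rewrite !inE negb_and negbK andb_orl andbN /=.
    by have [->|] := eqVneq x u; rewrite ?ut ?andbT.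
  have xu : u != x by apply: contraNneq xt => <-.
  rewrite coneE !inE ut orbT /= setDUl; congr (z (_ :|: _)).
  by apply/setDidPl; rewrite disjoints1 !inE eq_sym.
rewrite (bigD1 u) //= coneE setU11 setU1K //= big1 ?addr0 ?addbF //.
by move=> x /andP[_ xu]; rewrite coneE !inE eq_sym (negPf xu) (negPf ut).
Qed.

Definition carried P m z := forall sigma, z sigma -> P sigma && (#|sigma| == m).

Lemma carried0 P m : carried P m 0.
Proof. by move=> sigma; rewrite chain0. Qed.

Lemma carriedD P m y z : carried P m y -> carried P m z -> carried P m (y + z).
Proof.
move=> Hy Hz sigma; rewrite chainD; have [/Hy //|_] := boolP (y sigma).
by rewrite addFb => /Hz.
Qed.

Lemma carried_sum (I : finType) (p : pred I) (F : I -> chain) P m :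
  (forall i, p i -> carried P m (F i)) -> carried P m (\sum_(i | p i) F i).
Proof.
move=> HF; elim/big_rec: _ => [|i z pi Hz]; first exact: carried0.
by apply: carriedD => //; apply: HF.
Qed.

Lemma carriedW P Q m z : (forall sigma, P sigma -> Q sigma) ->
  carried P m z -> carried Q m z.
Proof. by move=> PQ Hz sigma /Hz/andP[/PQ-> ->]. Qed.

Lemma carried_bd P m z :
  (forall sigma tau, tau \subset sigma -> P sigma -> P tau) ->
  carried P m.+1 z -> carried P m (bd z).
Proof.
move=> Pdown Hz tau; rewrite bdE sum_bool_odd.
have [->|[x]] := set_0Vmem [set x | x \notin tau & z (x |: tau)].
  by rewrite cards0.
rewrite inE => /andP[xt /Hz/andP[/Pdown -> /=]]; last exact: subsetUr.
by rewrite cardsU1 xt eqSS => ->.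
Qed.

Definition fillable P m :=
  forall z, carried P m z -> bd z = 0 -> exists2 y, carried P m.+1 y & bd y = z.

End Chains.

(** * Acyclicity of the complex of feasible sets *)

Section Vanishing.

Local Open Scope ring_scope.

Variable V : finType.
Implicit Types (O : orientedMatroid (option V)) (A sigma tau : {set V}) (u : V).

Definition feasible O sigma :=
  [exists Psi in covectors O,
    (Psi None == Pos) && [forall u in sigma, Psi (Some u) != Pos]].

Lemma feasibleP O sigma :
  reflect (exists2 Psi, Psi \in covectors O &
             Psi None = Pos /\ {in sigma, forall u, Psi (Some u) != Pos})
          (feasible O sigma).
Proof.
apply: (iffP exists_inP) => -[Psi OPsi].
  by case/andP=> /eqP PsiN /forall_inP H; exists Psi.
by case=> PsiN H; exists Psi => //; rewrite PsiN eqxx; apply/forall_inP.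
Qed.

Lemma feasible_sub O sigma tau :
  tau \subset sigma -> feasible O sigma -> feasible O tau.
Proof.
move=> /subsetP ts /feasibleP[Psi OPsi [PsiN H]]; apply/feasibleP.
by exists Psi => //; split=> // u /ts /H.
Qed.

Lemma feasible_rank O sigma : feasible O sigma -> (0 < om_rank O)%N.
Proof.
case/feasibleP=> Psi OPsi [PsiN _]; apply: (om_rank_max (s := [:: Psi])).
have lt0 : sv_lt sv0 Psi.
  apply/andP; split; last by apply/forallP=> e; rewrite ffunE.
  apply/eqP=> /(congr1 (fun Phi : signvec _ => Phi None)).
  by rewrite ffunE PsiN.
by rewrite /om_chain /= OPsi lt0.
Qed.

(** In the contraction, [u] is a loop and its half-space is everything. *)
Lemma feasible_contract O u sigma :
  feasible (contract O (Some u)) sigma -> feasible O (u |: sigma).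
Proof.
case/feasibleP=> Psi; rewrite in_contract => /andP[OPsi /eqP Psiu] [PsiN H].
apply/feasibleP; exists Psi => //; split=> // x.
by case/setU1P=> [->|/H //]; rewrite Psiu.
Qed.

(** Convexity: an intersection of half-spaces that meets both closed sides of
    the hyperplane of [u] meets the hyperplane, by elimination. *)
Lemma feasible_crossing O u sigma Psi :
  feasible O (u |: sigma) ->
  Psi \in covectors O -> Psi None = Pos ->
  {in sigma, forall x, Psi (Some x) != Pos} ->
  Psi (Some u) != Neg -> feasible (contract O (Some u)) sigma.
Proof.
case/feasibleP=> Phi OPhi [PhiN PhiS] OPsi PsiN PsiS Psiu.
have Phiu : Phi (Some u) != Pos by apply: PhiS; rewrite setU11.
have {}PhiS : {in sigma, forall x, Phi (Some x) != Pos}.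
  by move=> x xs; apply: PhiS; rewrite inE xs orbT.
have [Phi0|Phi0] := eqVneq (Phi (Some u)) Zero.
  by apply/feasibleP; exists Phi; rewrite ?in_contract ?OPhi ?Phi0.
have [Psi0|Psi0] := eqVneq (Psi (Some u)) Zero.
  by apply/feasibleP; exists Psi; rewrite ?in_contract ?OPsi ?Psi0.
have [|T [OT Tu TE]] := covectors_elim (v := Some u) OPsi OPhi.
  rewrite !inE; case: (Psi _) Psiu Psi0 => //.
  by case: (Phi _) Phiu Phi0.
apply/feasibleP; exists T; first by rewrite in_contract OT Tu.
split; first by rewrite TE ?inE ?ffunE PsiN ?PhiN.
move=> x xs; rewrite TE ?inE ?ffunE.
  by case: (Psi (Some x)) (PsiS x xs) (PhiS x xs) => //.
by case: (Psi (Some x)) (PsiS x xs) (PhiS x xs) => // _; case: (Phi (Some x)).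
Qed.

Definition induced (X : pred {set V}) A : pred {set V} :=
  fun sigma => X sigma && (sigma \subset A).

(** Split a cycle [z] as [z0 + u * z1], so that [z1 = bd z0] is a cycle of the
    link of [u]. A chain [w] of the link with [bd w = z1] replaces [z] by the
    homologous cycle [z0 + w], which avoids [u]. Such a [w] comes from
    Mayer-Vietoris along the hyperplane of [u], the sizes dropping by one
    together with the rank; if [u] is a loop, [w] is [z0]. *)
Lemma feasible_fillable O A m :
  (om_rank O <= m)%N -> fillable (induced (feasible O) A) m.
Proof.
elim: {A}_.+1 {-2}A (ltnSn #|A|) O m => // n IH A leAn O m rkO z Pz z_cycle.
have [A0|[u uA]] := set_0Vmem A.
  exists 0; first exact: carried0.
  rewrite bd0; apply/ffunP=> sigma; rewrite chain0; apply/esym/negP.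
  case/Pz/andP=> /andP[feas]; rewrite A0 subset0 => /eqP-> /eqP m0.
  by move: (leq_trans (feasible_rank feas) rkO); rewrite -m0 cards0.
set A' := A :\ u.
have ltA : (#|A'| < n)%N by move: leAn; rewrite (cardsD1 u A) uA.
have notA' sigma : sigma \subset A' -> u \notin sigma.
  by move=> /subsetP sA; apply/negP=> /sA; rewrite !inE eqxx.
have subA' sigma : u \notin sigma -> (sigma \subset A') = (sigma \subset A).
  by move=> us; rewrite subsetD1 us andbT.
pose Nminus sigma := induced (fun tau => feasible O (u |: tau)) A' sigma.
pose z1 : chain V :=
  [ffun sigma : {set V} => (u \notin sigma) && z (u |: sigma)].
pose z0 : chain V := [ffun sigma : {set V} => (u \notin sigma) && z sigma].
have zE : z = z0 + cone u z1.
  apply/ffunP=> sigma; rewrite chainD coneE !ffunE setD11 /=.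
  have [us|us] := boolP (u \in sigma); last by rewrite /= addbF.
  by rewrite setD1K.
have z1E : z1 = bd z0.
  apply/ffunP=> sigma; have [us|us] := boolP (u \in sigma).
    rewrite ffunE us bdE big1 // => x _.
    by rewrite ffunE inE us orbT.
  move: z_cycle => /(congr1 (fun c : chain V => c sigma)).
  rewrite {1}zE bdD bd_cone !chainD coneE (negPf us) /= addbF chain0.
  by case: (bd z0 sigma); case: (z1 sigma).
have Pz0 : carried (induced (feasible O) A') m z0.
  move=> sigma; rewrite ffunE => /andP[us /Pz/andP[/andP[feas sA] ->]].
  by rewrite /induced feas subA' // sA.
suff [w Pw bdw] : exists2 w, carried Nminus m w & bd w = z1.
  have Pzw : carried (induced (feasible O) A') m (z0 + w).
    apply: carriedD => //; apply: carriedW Pw => sigma /andP[feas sA].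
    by rewrite /induced sA andbT; apply: feasible_sub feas; apply: subsetUr.
  have [|y Py bdy] := IH _ ltA O m rkO _ Pzw.
    by rewrite bdD bdw z1E chainDD.
  exists (y + cone u w).
    apply: carriedD.
      apply: carriedW Py => sigma /andP[feas sA]; rewrite /induced feas.
      exact: subset_trans sA (subD1set _ _).
    move=> sigma; rewrite coneE => /andP[us /Pw/andP[/andP[]]].
    rewrite setD1K // => feas sA /eqP <-.
    rewrite /induced feas (cardsD1 u sigma) us eqxx andbT.
    rewrite -(setD1K us) subUset sub1set uA.
    exact: subset_trans sA (subD1set _ _).
  by rewrite bdD bdy bd_cone bdw zE addrA -[z0 + w + w]addrA chainDD addr0.
have [/exists_inP[Psi0 OPsi0 Psi0u]|loop] :=
  boolP [exists Psi in covectors O, Psi (Some u) != Zero]; last first.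
  exists z0; last by [].
  move=> sigma /Pz0/andP[/andP[/feasibleP[Psi OPsi [PsiN H]] sA] ->].
  rewrite andbT /Nminus /induced sA andbT; apply/feasibleP; exists Psi => //.
  split=> // x /setU1P[->|/H //]; apply/eqP=> Psiu.
  by move: loop; rewrite negb_exists => /forallP/(_ Psi); rewrite OPsi Psiu.
have rkc := om_rank_contract OPsi0 Psi0u.
case: m rkO Pz Pz0 => [|m] rkO Pz Pz0; first by move: (leq_trans rkc rkO).
(* Mayer-Vietoris for the hyperplane of u: p is the part of z0 met by the closed
   side where u is nonpositive, q lives on the other closed side, so bd q lives
   on both, hence on the hyperplane itself. *)
pose p : chain V :=
  [ffun sigma : {set V} => z0 sigma && feasible O (u |: sigma)].
have Pp : carried Nminus m.+1 p.
  move=> sigma; rewrite ffunE => /andP[/Pz0/andP[/andP[_ sA] ->] feas].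
  by rewrite /Nminus /induced feas sA.
pose q := z0 + p.
pose Nplus sigma := (sigma \subset A') && [exists Psi in covectors O,
   [&& Psi None == Pos, Psi (Some u) != Neg
     & [forall x in sigma, Psi (Some x) != Pos]]].
have Pq : carried Nplus m.+1 q.
  move=> sigma; rewrite chainD [p _]ffunE.
  have [zs|//] := boolP (z0 sigma); rewrite /= => nfeas.
  have /andP[/andP[/feasibleP[Psi OPsi [PsiN H]] sA] ->] := Pz0 _ zs.
  rewrite /Nplus sA andbT; apply/exists_inP; exists Psi => //.
  rewrite PsiN eqxx /=; apply/andP; split; last exact/forall_inP.
  apply: contraNneq nfeas => Psiu; apply/feasibleP.
  exists Psi => //; split=> // x.
  by case/setU1P=> [->|/H //]; rewrite Psiu.
have bdq : bd q = z1 + bd p by rewrite bdD z1E.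
have Pbdq : carried (induced (feasible (contract O (Some u))) A') m (bd q).
  have mdown : carried Nminus m (bd q).
    rewrite bdq; apply: carriedD.
      move=> sigma; rewrite ffunE => /andP[us /Pz/andP[/andP[feas sA]]].
      rewrite cardsU1 us eqSS => ->; rewrite /Nminus /induced feas subA' //.
      by rewrite (subset_trans _ sA) // subsetUr.
    apply: carried_bd Pp => sigma tau ts /andP[feas sA].
    rewrite /Nminus /induced (subset_trans ts sA) andbT.
    by apply: feasible_sub feas; apply: setUS.
  have pdown : carried Nplus m (bd q).
    apply: carried_bd Pq => sigma tau ts /andP[sA /exists_inP[Psi OPsi]].
    case/and3P=> PsiN Psiu /forall_inP H.
    rewrite /Nplus (subset_trans ts sA); apply/exists_inP; exists Psi => //.
    rewrite PsiN Psiu; apply/forall_inP=> x xt; apply: H.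
    exact: (subsetP ts).
  move=> sigma bq; have /andP[/andP[feas sA] ->] := mdown _ bq.
  rewrite /induced sA !andbT.
  have /andP[/andP[_ /exists_inP[Psi OPsi]]] := pdown _ bq.
  case/and3P=> /eqP PsiN Psiu /forall_inP H _.
  exact: feasible_crossing feas OPsi PsiN H Psiu.
have [||t Pt bdt] := IH _ ltA (contract O (Some u)) m _ _ Pbdq.
- by rewrite -ltnS (leq_trans rkc).
- exact: bd_bd.
exists (p + t).
  apply: carriedD => //; apply: carriedW Pt => sigma /andP[feas sA].
  by rewrite /Nminus /induced sA feasible_contract.
by rewrite bdD bdt bdq addrC -addrA chainDD addr0.
Qed.

End Vanishing.

(** * A colourful theorem for complexes with vanishing homology *)

Section Colours.

Local Open Scope ring_scope.

Variables (V C : finType) (col : V -> C).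
Implicit Types (A B R T sigma tau : {set V}) (S : {set C}) (x e u : V) (k : C).
Implicit Types (c w : {set V} -> chain V).

Definition colour_class k : {set V} := [set x | col x == k].

Definition mult A k := #|A :&: colour_class k|.

Lemma in_class x k : (x \in colour_class k) = (col x == k).
Proof. by rewrite inE. Qed.

Lemma multD1 x A k :
  mult A k = ((x \in A) && (col x == k) + mult (A :\ x) k)%N.
Proof. by rewrite /mult (cardsD1 x) inE in_class setIDAC. Qed.

Lemma multU1 x A k :
  mult (x |: A) k = ((x \notin A) && (col x == k) + mult A k)%N.
Proof.
rewrite (multD1 x) setU11 /=; have [xA|xA] := boolP (x \in A); last first.
  by rewrite setU1K.
by rewrite [x |: A](setUidPr _) ?sub1set // (multD1 x A) xA.
Qed.

Lemma leq_mult A B k : A \subset B -> (mult A k <= mult B k)%N.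
Proof. by move=> AB; apply/subset_leq_card/setSI. Qed.

Definition coloured S A := [forall x in A, col x \in S].

Lemma colouredP S A : reflect {in A, forall x, col x \in S} (coloured S A).
Proof. exact: forall_inP. Qed.

Lemma coloured_sub S A B : B \subset A -> coloured S A -> coloured S B.
Proof. by move=> /subsetP BA /colouredP H; apply/colouredP=> x /BA/H. Qed.

Lemma card_coloured S A : coloured S A -> #|A| = (\sum_(k in S) mult A k)%N.
Proof.
move=> /colouredP AS; rewrite -sum1_card (partition_big col (mem S)) //=.
apply: eq_bigr => k _; rewrite /mult -sum1_card; apply: eq_bigl => x.
by rewrite !inE.
Qed.

Definition good S A := coloured S A && [forall k in S, 1 < mult A k].

Definition tight S A := coloured S A && [forall k in S, mult A k == 2].

Definition rainbow S R := coloured S R && [forall k in S, mult R k == 1].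

Lemma goodP S A :
  reflect (coloured S A /\ {in S, forall k, 1 < mult A k}) (good S A).
Proof. by apply: (iffP andP) => -[AS /forall_inP]. Qed.

Lemma tightP S A :
  reflect (coloured S A /\ {in S, forall k, mult A k = 2}) (tight S A).
Proof.
apply: (iffP andP) => -[AS H]; split=> //.
  by move=> k kS; apply/eqP/(forall_inP H).
by apply/forall_inP=> k kS; apply/eqP/H.
Qed.

Lemma rainbowP S R :
  reflect (coloured S R /\ {in S, forall k, mult R k = 1}) (rainbow S R).
Proof.
apply: (iffP andP) => -[AS H]; split=> //.
  by move=> k kS; apply/eqP/(forall_inP H).
by apply/forall_inP=> k kS; apply/eqP/H.
Qed.

Lemma good_leq_card S A : good S A -> (#|S| + #|S| <= #|A|)%N.
Proof.
case/goodP=> AS A2; rewrite (card_coloured AS) addnn -muln2 -sum_nat_const.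
exact: leq_sum.
Qed.

Lemma tight_card S A : tight S A -> #|A| = (#|S| + #|S|)%N.
Proof.
case/tightP=> AS A2; rewrite (card_coloured AS) addnn -muln2 -sum_nat_const.
exact: eq_bigr.
Qed.

Lemma rainbow_card S R : rainbow S R -> #|R| = #|S|.
Proof.
case/rainbowP=> RS R1; rewrite (card_coloured RS) -sum1_card; exact: eq_bigr.
Qed.

Lemma tight_good S A : tight S A -> good S A.
Proof. by case/tightP=> AS A2; apply/goodP; split=> // k /A2->. Qed.

Lemma good_super S A B : B \subset A -> coloured S A -> good S B -> good S A.
Proof.
move=> BA AS /goodP[_ B2]; apply/goodP; split=> // k /B2 /leq_trans; apply.
exact: leq_mult.
Qed.

(** The boundary of a cross-polytope whose antipodal pairs are the two elements
    of [A] in each colour. It is extended by 0 to other sets [A], which lets the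
    equation of a [system] be written uniformly. *)
Definition crosspolytope S A : chain V :=
  [ffun R : {set V} => [&& tight S A, rainbow S R & R \subset A]].

Lemma crosspolytopeE S A R :
  crosspolytope S A R = [&& tight S A, rainbow S R & R \subset A].
Proof. by rewrite ffunE. Qed.

Lemma crosspolytope0 S A : ~~ tight S A -> crosspolytope S A = 0.
Proof.
by move=> nt; apply/ffunP=> R; rewrite crosspolytopeE chain0 (negPf nt).
Qed.

(** A set with one colour missing is a face of two rainbow sets, one for each
    element of [A] in that colour. *)
Lemma bd_crosspolytope S A : bd (crosspolytope S A) = 0.
Proof.
apply/ffunP=> tau; rewrite bdE chain0 sum_bool_odd.
have [->|[x]] :=
  set_0Vmem [set x | x \notin tau & crosspolytope S A (x |: tau)].
  by rewrite cards0.
rewrite inE crosspolytopeE => /and4P[xt tA /rainbowP[RS R1] RA].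
have [_ A2] := tightP _ _ tA.
have xS : col x \in S by apply: (colouredP _ _ RS); rewrite setU11.
suff -> : [set y | y \notin tau & crosspolytope S A (y |: tau)]
            = A :&: colour_class (col x).
  by rewrite -/(mult _ _) A2.
have tx : mult tau (col x) = 0%N.
  by move: (R1 _ xS); rewrite multU1 xt eqxx => -[].
apply/setP=> y; rewrite !inE crosspolytopeE tA /=.
apply/andP/andP=> [[yt /andP[/rainbowP[_ R1'] R'A]]|[yA /eqP yx]].
  split; first by rewrite (subsetP R'A) ?setU11.
  by move: (R1' _ xS); rewrite multU1 yt tx; case: eqP.
have yt : y \notin tau.
  apply/negP=> yt; move/eqP: tx; rewrite cards_eq0 => /eqP/setP/(_ y).
  by rewrite !inE yt yx eqxx.
split=> //; apply/andP; split; last first.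
  by rewrite subUset sub1set yA (subset_trans _ RA) ?subsetUr.
apply/rainbowP; split=> [|k /R1]; last by rewrite !multU1 xt yt yx.
apply/colouredP=> v /setU1P[->|vt]; first by rewrite yx.
by apply: (colouredP _ _ RS); rewrite inE vt orbT.
Qed.

(** Only the sets [A] with three elements of one colour and two of the others
    contribute; a rainbow set then survives the deletion of either of the two
    elements of that colour that it does not use. *)
Lemma sum_crosspolytope S A :
  good S A -> \sum_(e in A) crosspolytope S (A :\ e) = 0.
Proof.
move=> gA; have [AS _] := goodP _ _ gA.
apply/ffunP=> R; rewrite chain_sum chain0 sum_bool_odd.
have [->|[x]] := set_0Vmem [set e | (e \in A) && crosspolytope S (A :\ e) R].
  by rewrite cards0.
rewrite inE crosspolytopeE => /and4P[xA /tightP[_ A2] rR RA].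
have [RS R1] := rainbowP _ _ rR.
have xS : col x \in S by apply: (colouredP _ _ AS).
suff -> : [set e | (e \in A) && crosspolytope S (A :\ e) R]
            = (A :&: colour_class (col x)) :\: (R :&: colour_class (col x)).
  have RAx : R :&: colour_class (col x) \subset A :&: colour_class (col x).
    by apply: setSI; apply: subset_trans RA (subD1set _ _).
  rewrite cardsD (setIidPr RAx) -!/(mult _ _) R1 //.
  by rewrite (multD1 x) A2 // xA eqxx.
have RA' : R \subset A by apply: subset_trans RA (subD1set _ _).
apply/setP=> y; rewrite !inE crosspolytopeE rR subsetD1 RA' /=.
have [yA|] := boolP (y \in A); last by rewrite ?andbF.
rewrite /= andbC negb_and; have [yR|yR] := boolP (y \in R) => /=.
  by case: (col y == _).
have [yx|yx] := eqVneq (col y) (col x).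
  apply/tightP; split=> [|k kS]; first exact: coloured_sub (subD1set _ _) AS.
  by have := multD1 x A k; rewrite (multD1 y A k) xA yA yx A2 // => /addnI.
apply/negP=> /tightP[_ /(_ _ xS)]; have := multD1 x A (col x).
by rewrite (multD1 y) yA (negPf yx) xA eqxx A2 // add0n => ->.
Qed.

(** The chains [c_A] that fill one another. They vanish where some colour of
    [S] occurs at most once, so the sum over all [e] in [A] only involves the
    deletions that keep two elements of each colour. *)
Definition system (X : pred {set V}) S c := forall A, coloured S A ->
  [/\ forall sigma, c A sigma -> induced X A sigma,
      ~~ good S A -> c A = 0 &
      bd (c A) = crosspolytope S A + \sum_(e in A) c (A :\ e)].

(** The chains are built by increasing size of [A]. The chain to be filled is a
    cycle: the cross-polytope terms cancel, and so does the double sum of the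
    chains with two elements deleted. Its sets have size [#|A| - #|S|], which is
    at least [#|S|] as [A] contains two elements of every colour. *)
Lemma system_exists (X : pred {set V}) S :
  (forall A m, (#|S| <= m)%N -> fillable (induced X A) m) ->
  (forall R, rainbow S R -> X R) ->
  exists c, system X S c.
Proof.
move=> fillX rainbowX.
pose ok c A z := [/\ carried (induced X A) (#|A| - #|S|).+1 z,
   ~~ good S A -> z = 0 &
   bd z = crosspolytope S A + \sum_(e in A) c (A :\ e)].
suff [c Hc] : exists c, forall A,
    coloured S A -> (#|A| < #|V|.+1)%N -> ok c A (c A).
  exists c => A AS; have [|Xc c0 bdc] := Hc A AS.
    by rewrite ltnS max_card.
  by split=> // sigma /Xc/andP[].
elim: (#|V|.+1) => [|n [c IH]]; first by exists (fun=> 0).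
suff /fin_all_exists[c' Hc'] : forall A, exists z, coloured S A ->
    if #|A| == n then ok c A z else z = c A.
  exists c' => A AS; rewrite ltnS => leAn.
  have okW z : ok c A z -> ok c' A z.
    case=> Xz z0 bdz; split=> //; rewrite bdz; congr (_ + _).
    apply: eq_bigr => e eA.
    have := Hc' (A :\ e) (coloured_sub (subD1set _ _) AS).
    by case: eqP => // Ae; move: leAn; rewrite (cardsD1 e) eA Ae ltnn.
  apply: okW; have := Hc' A AS; case: eqP => // nA ->.
  by apply: IH => //; rewrite ltn_neqAle leAn andbT; apply/eqP.
move=> A; have [AS|] := boolP (coloured S A); last by exists 0.
have [An|_] := eqVneq #|A| n; last by exists (c A).
have ltAe e : e \in A -> (#|A :\ e| < n)%N.
  by move=> eA; rewrite -An (cardsD1 e A) eA.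
have AeS e : coloured S (A :\ e) by apply: coloured_sub (subD1set _ _) AS.
have [gA|ngA] := boolP (good S A); last first.
  exists 0 => _; split=> //; first exact: carried0.
  rewrite bd0 crosspolytope0 ?add0r ?big1 // => [e eA|].
    have [_ c0 _] := IH _ (AeS e) (ltAe e eA); apply: c0.
    by apply: contraNN ngA; apply: good_super (subD1set _ _) AS.
  by apply: contraNN ngA; apply: tight_good.
have leA := good_leq_card gA.
have [|||z Xz bdz] := fillX A (#|A| - #|S|)%N _
    (crosspolytope S A + \sum_(e in A) c (A :\ e)).
- by rewrite leq_subRL // (leq_trans _ leA) // leq_addr.
- apply: carriedD.
    move=> R; rewrite crosspolytopeE => /and3P[tA rR RA].
    rewrite /induced rainbowX // RA (tight_card tA) addnK.
    by rewrite (rainbow_card rR) eqxx.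
  apply: carried_sum => e eA; have [Xc c0 _] := IH _ (AeS e) (ltAe e eA).
  have [gAe|/c0->] := boolP (good S (A :\ e)); last exact: carried0.
  move=> sigma /Xc; have := good_leq_card gAe.
  rewrite (cardsD1 e A) eA add1n => leAe.
  rewrite subSn; last by apply: leq_trans leAe; apply: leq_addr.
  case/andP=> /andP[Xs sA] ->; rewrite /induced Xs andbT /=.
  exact: subset_trans sA (subD1set _ _).
- rewrite bdD bd_crosspolytope add0r bd_sum.
  under eq_bigr => e eA do have [_ _ ->] := IH _ (AeS e) (ltAe e eA).
  rewrite big_split /= sum_crosspolytope // add0r.
  rewrite -[RHS](sum_sym_eq0 (f := fun e e' => c (A :\ e :\ e')) (mem A)
    (@chainDD V)).
    by apply: eq_bigr => e _; apply: eq_bigl => e'; rewrite !inE andbC.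
  by move=> e e'; rewrite !setDDl [X in _ :\: X]setUC.
by exists z => _; split=> //; rewrite gA.
Qed.



Lemma disjointsU1 x A B :
  [disjoint x |: A & B] = (x \notin B) && [disjoint A & B].
Proof. by rewrite -disjointU1; apply: eq_disjoint => y; rewrite !inE. Qed.

Section EliminateColour.

Variables (X : pred {set V}) (S : {set C}) (k0 : C).
Hypothesis k0S : k0 \in S.

Let U := colour_class k0.
Let S' := S :\ k0.

Implicit Types y z : chain V.

(** The coefficient of [T] when a chain is expanded along the colour class [U]:
    the sets disjoint from [U] whose union with [T] is in the chain. *)
Definition slice T z : chain V :=
  [ffun sigma : {set V} => [disjoint sigma & U] && z (T :|: sigma)].

Lemma sliceE T z sigma :
  slice T z sigma = [disjoint sigma & U] && z (T :|: sigma).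
Proof. by rewrite ffunE. Qed.

Lemma slice0 T : slice T 0 = 0.
Proof. by apply/ffunP=> sigma; rewrite sliceE !chain0 andbF. Qed.

Lemma sliceD T y z : slice T (y + z) = slice T y + slice T z.
Proof.
by apply/ffunP=> sigma; rewrite chainD !sliceE chainD; case: [disjoint _ & _].
Qed.

Lemma slice_sum (I : finType) (p : pred I) (F : I -> chain V) T :
  slice T (\sum_(i | p i) F i) = \sum_(i | p i) slice T (F i).
Proof. by elim/big_rec2: _ => [|i b z _ <-]; rewrite ?slice0 ?sliceD. Qed.

(** Among the faces that meet [U] in [T], those that arise by deleting an
    element of [U] come from sets meeting [U] in [u |: T]. *)
Lemma bd_slice T u z :
  u \notin T -> u \in U -> T \subset U ->
  (forall sigma, z sigma -> sigma :&: U \subset u |: T) ->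
  bd (slice T z) = slice T (bd z) + slice (u |: T) z.
Proof.
move=> uT uU TU zU; apply/ffunP=> tau; rewrite chainD !sliceE !bdE.
have [tauU|tauU] := boolP [disjoint tau & U] => /=; last first.
  by rewrite big1 // => x _; rewrite sliceE disjointsU1 (negPf tauU) andbF.
have uTt : u \notin T :|: tau.
  rewrite inE negb_or uT; apply/negP=> ut.
  by rewrite (disjointFr tauU ut) in uU.
rewrite (bigID (mem U)) [X in _ = X (+) _](bigID (mem U)) /=.
rewrite big1 ?add0r; last first.
  by move=> x /andP[_ xU]; rewrite sliceE disjointsU1 xU.
rewrite [X in _ = (X + _) (+) _](bigD1 u) ?uTt //=.
rewrite [X in _ = (_ + X + _) (+) _]big1 ?addr0; last first.
  move=> x /andP[/andP[xTt xU] xu]; apply/negbTE/negP=> /zU/subsetP/(_ x).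
  rewrite in_setI setU11 xU => /(_ isT); rewrite in_setU1 (negPf xu) /= => xT.
  by rewrite inE xT in xTt.
rewrite setUA; set a := z _; set s2 := (X in _ = (_ + X) (+) _).
suff -> : \sum_(x | (x \notin tau) && (x \notin U)) slice T z (x |: tau) = s2.
  by rewrite -[RHS]/(a + s2 + a) addrAC boolDD add0r.
apply: eq_big => [x|x /andP[_ xU]].
  rewrite in_setU negb_or andbAC.
  case: (boolP (x \in U)) => xU; rewrite ?andbF ?andbT //.
  by rewrite (contraNN (subsetP TU x)) // andbT.
by rewrite sliceE disjointsU1 (negPf xU) tauU /= setUCA.
Qed.


Lemma coloured_disjoint A : coloured S' A -> [disjoint A & U].
Proof.
move=> /colouredP AS; rewrite disjoint_subset; apply/subsetP=> x /AS.
by rewrite !inE => /andP[].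
Qed.

Lemma colouredU T A : T \subset U -> coloured S' A -> coloured S (T :|: A).
Proof.
move=> /subsetP TU /colouredP AS; apply/colouredP=> x /setUP[/TU|/AS].
  by rewrite inE => /eqP->.
by rewrite inE => /andP[].
Qed.

Lemma multU_head T A : T \subset U -> [disjoint A & U] ->
  mult (T :|: A) k0 = #|T|.
Proof.
move=> TU AU; rewrite /mult setIUl -/U.
by rewrite (disjoint_setI0 AU) setU0 (setIidPl TU).
Qed.

Lemma multU_tail T A k : T \subset U -> k != k0 -> mult (T :|: A) k = mult A k.
Proof.
move=> /subsetP TU kk0; congr #|pred_of_set _|; apply/setP=> x; rewrite !inE.
have [/TU|//] := boolP (x \in T); rewrite inE => /eqP->.
by rewrite eq_sym (negPf kk0) !andbF.
Qed.

(** A cross-polytope is the suspension, with apices [u] and [v], of the one with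
    the colour of [u] and [v] left out. *)
Lemma slice_crosspolytope1 u v A :
  u \in U -> v \in U -> u != v -> coloured S' A ->
  slice [set u] (crosspolytope S (v |: (u |: A))) = crosspolytope S' A.
Proof.
move=> uU vU uv AS.
have AU := coloured_disjoint AS.
have uvU : [set v; u] \subset U by rewrite subUset !sub1set uU vU.
have uU' : [set u] \subset U by rewrite sub1set.
have S'P k : (k \in S') = (k != k0) && (k \in S) by rewrite in_setD1.
have tE : tight S (v |: (u |: A)) = tight S' A.
  rewrite setUA; apply/tightP/tightP => -[AS1 A2].
    split=> // k; rewrite S'P => /andP[kk0 kS].
    by rewrite -(multU_tail A uvU kk0) A2.
  split=> [|k kS]; first exact: colouredU.
  have [->|kk0] := eqVneq k k0; first by rewrite multU_head // cards2 eq_sym uv.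
  by rewrite multU_tail // A2 // S'P kk0.
apply/ffunP=> R; rewrite sliceE !crosspolytopeE tE.
have [RU|RU] /= := boolP [disjoint R & U]; last first.
  apply/esym/and3P=> -[_ /rainbowP[RS _] _].
  by rewrite (coloured_disjoint RS) in RU.
congr [&& _, _ & _].
  apply/rainbowP/rainbowP => -[RS R1]; split.
  - apply/colouredP=> x xR.
    rewrite S'P (colouredP _ _ RS) ?inE ?xR ?orbT // andbT.
    by have := disjointFr RU xR; rewrite inE => ->.
  - move=> k; rewrite S'P => /andP[kk0 kS].
    by rewrite -(multU_tail R uU' kk0) R1.
  - exact: colouredU.
  move=> k kS; have [->|kk0] := eqVneq k k0.
    by rewrite multU_head // cards1.
  by rewrite multU_tail // R1 // S'P kk0.
rewrite subUset sub1set !inE eqxx !orbT /=.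
apply/subsetP/subsetP=> RA x xR; last by rewrite !inE RA ?orbT.
move: (RA x xR); rewrite !inE; have := disjointFr RU xR.
by case: eqP => [->|_]; rewrite ?vU //; case: eqP => [->|//]; rewrite uU.
Qed.

Lemma slice_crosspolytope2 T A :
  T \subset U -> (1 < #|T|)%N -> slice T (crosspolytope S A) = 0.
Proof.
move=> TU T2; apply/ffunP=> R; rewrite sliceE crosspolytopeE chain0.
apply/negbTE/negP=> /and4P[RU _ /rainbowP[_ /(_ _ k0S)]].
by rewrite multU_head // => T1; rewrite T1 in T2.
Qed.

(** Along a flag of subsets of [U] that grows one element [u] at a time, sum the
    slices at [T] of the chains with ground set [u |: T :|: A]. In the boundary of
    this sum, [bd_slice] and the equation of the system make all the slices at
    intermediate steps telescope. What remains is the cross-polytope of the other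
    colours, from the start of the flag where [T] is a single point, and the
    slice at [U] itself, which is 0 because no set of [X] contains [U]. *)
Lemma system_eliminate c :
  (forall sigma tau, tau \subset sigma -> X sigma -> X tau) ->
  ~~ X U -> (1 < #|U|)%N -> system X S c -> exists w, system X S' w.
Proof.
move=> Xdown nXU U2 sysc.
(* The term g T A is the one that telescopes. The singleton case has to be set
   apart because c vanishes on ground sets with a single element of U. *)
pose g T A := if #|T| == 1%N then crosspolytope S' A else slice T (c (T :|: A)).
suff /(_ #|U| U (leqnn _) (subxx _)) [|w Hw] : forall n T, (#|T| <= n)%N ->
    T \subset U -> (0 < #|T|)%N -> exists w, forall A, coloured S' A ->
    [/\ forall sigma, w A sigma -> induced X A sigma,
      ~~ good S' A -> w A = 0 &
      bd (w A) = crosspolytope S' A + g T A + \sum_(e in A) w (A :\ e)].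
- exact: ltnW.
- exists w => A AS; have [Xw w0 bdw] := Hw A AS; split=> //.
  rewrite bdw /g gtn_eqF // (_ : slice _ _ = 0) ?addr0 //.
  apply/ffunP=> sigma; rewrite sliceE chain0; apply/negbTE/negP=> /andP[_].
  have [Xc _ _] := sysc _ (colouredU (subxx U) AS).
  move=> /Xc/andP[/(Xdown _ U) XU _]; move: nXU; rewrite XU //.
  exact: subsetUl.
elim=> [|n IH] T leTn TU T0; first by move: (leq_trans T0 leTn).
have [u uT] : exists u, u \in T by apply/set0Pn; rewrite -card_gt0.
have [T1|T1] := eqVneq #|T| 1%N.
  exists (fun=> 0) => A AS; split=> // [sigma|]; first by rewrite chain0.
  by rewrite bd0 /g T1 eqxx chainDD add0r big1.
have T2 : (1 < #|T|)%N by rewrite ltn_neqAle eq_sym T1.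
pose T' := T :\ u.
have uT' : u \notin T' by rewrite !inE eqxx.
have TE : T = u |: T' by rewrite setD1K.
have T'n : #|T| = #|T'|.+1 by rewrite (cardsD1 u T) uT.
have T'U : T' \subset U by apply: subset_trans TU; apply: subD1set.
have uU : u \in U by apply: (subsetP TU).
have T'0 : (0 < #|T'|)%N by move: T2; rewrite T'n.
have [|w Hw] := IH T' _ T'U T'0; first by rewrite -ltnS -T'n.
pose y A := if coloured S' A then slice T' (c (T :|: A)) else 0.
exists (fun A => w A + y A) => A AS.
have [Xw w0 bdw] := Hw A AS.
have AU := coloured_disjoint AS.
have BS := colouredU TU AS.
have [XB B0 bdB] := sysc _ BS.
have yE e : y (A :\ e) = slice T' (c (T :|: (A :\ e))).
  by rewrite /y (coloured_sub (subD1set _ _) AS).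
split.
- move=> sigma; rewrite chainD /y AS; have [/Xw //|_] := boolP (w A sigma).
  rewrite addFb sliceE => /andP[sU /XB/andP[Xs sB]].
  rewrite /induced (Xdown _ _ (subsetUr _ _) Xs).
  apply/subsetP=> x xs; have := subsetP sB x; rewrite !in_setU xs orbT.
  case/(_ isT)/orP=> // /(subsetP TU) xU.
  by rewrite (disjointFr sU xs) in xU.
- move=> nA; rewrite w0 // add0r /y AS B0 ?slice0 //.
  apply: contraNN nA => /goodP[_ B2]; apply/goodP; split=> // k.
  rewrite in_setD1 => /andP[kk0 kS].
  by rewrite -(multU_tail A TU kk0) B2.
have bdy : bd (y A) = g T' A + g T A + \sum_(e in A) y (A :\ e).
  rewrite /y AS (bd_slice (u := u)) //; last first.
    move=> sigma /XB/andP[_ /subsetP sB]; rewrite -TE.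
    apply/subsetP=> x /setIP[/sB/setUP[//|xA] xU].
    by rewrite (disjointFr AU xA) in xU.
  have -> : g T A = slice T (c (T :|: A)) by rewrite /g (negPf T1).
  rewrite -TE [RHS]addrAC; congr (_ + _).
  rewrite bdB sliceD slice_sum.
  rewrite (bigID (mem A)) /= [X in _ + (_ + X) = _](bigD1 u) /=; last first.
    rewrite in_setU uT /=; apply: contraL uU => uA.
    by rewrite (disjointFr AU uA).
  rewrite [X in _ + (_ + (_ + X)) = _]big1 ?addr0; last first.
    move=> e /andP[/andP[eB eA] eu].
    have eT : e \in T' by move: eB; rewrite in_setU (negPf eA) orbF !inE eu.
    apply/ffunP=> sigma; rewrite sliceE chain0; apply/negbTE/negP=> /andP[_].
    have [Xe _ _] := sysc _ (coloured_sub (subD1set _ e) BS).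
    move=> /Xe/andP[_ /subsetP/(_ e)]; rewrite in_setU eT => /(_ isT).
    by rewrite !inE eqxx.
  have -> : \sum_(e | (e \in T :|: A) && (e \in A))
      slice T' (c ((T :|: A) :\ e)) = \sum_(e in A) y (A :\ e).
    apply: eq_big => [e|e /andP[_ eA]].
      by rewrite in_setU; case: (e \in A); rewrite ?andbF ?orbT.
    rewrite yE setDUl; congr (slice _ (c (_ :|: _))).
    apply/setDidPl; rewrite disjoint_sym disjoints1.
    by apply/negP=> /(subsetP TU); rewrite (disjointFr AU eA).
  rewrite addrCA addrC; congr (_ + _).
  have -> : (T :|: A) :\ u = T' :|: A.
    rewrite setDUl -/T'; congr (_ :|: _); apply/setDidPl.
    rewrite disjoint_sym disjoints1; apply/negP=> uA.
    by rewrite (disjointFr AU uA) in uU.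
  rewrite /g; have [/eqP/cards1P[v T'v]|T'1] := eqVneq #|T'| 1%N.
    rewrite TE T'v -setUA slice_crosspolytope1 //.
    - have [_ c0 _] := sysc _ (colouredU T'U AS).
      rewrite -T'v c0 ?slice0 ?addr0 //.
      by apply/goodP=> -[_ /(_ _ k0S)]; rewrite multU_head // T'v cards1.
    - by rewrite -sub1set -T'v.
    - by move: uT'; rewrite T'v inE eq_sym.
  by rewrite slice_crosspolytope2 ?add0r // ltn_neqAle eq_sym T'1.
rewrite bdD bdw bdy big_split /= addrACA; congr (_ + _).
by rewrite -addrA chainDK.
Qed.

End EliminateColour.

(** Without colours, the chain attached to the empty ground set should have the
    empty set as its boundary, but it contains no singleton. *)
Lemma no_system0 (X : pred {set V}) c : ~ system X set0 c.
Proof.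
move=> sysc.
have S0 : coloured set0 set0 by apply/colouredP=> x; rewrite inE.
have [Xc _ /(congr1 (fun z : chain V => z set0))] := sysc _ S0.
rewrite chainD big_set0 chain0 crosspolytopeE subxx bdE big1 => [|x _].
  have -> : tight set0 set0 by apply/tightP; split=> // k; rewrite inE.
  have -> // : rainbow set0 set0 by apply/rainbowP; split=> // k; rewrite inE.
apply/negbTE/negP=> /Xc/andP[_]; rewrite setU0 subset0 => /eqP/setP/(_ x).
by rewrite !inE eqxx.
Qed.

Theorem colourful_simplex (X : pred {set V}) S :
  (forall sigma tau, tau \subset sigma -> X sigma -> X tau) ->
  (forall A m, (#|S| <= m)%N -> fillable (induced X A) m) ->
  (forall R, rainbow S R -> X R) ->
  {in S, forall k, colour_class k != set0} ->
  exists2 k, k \in S & X (colour_class k).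
Proof.
move=> Xdown fillX rainbowX classS.
have [/exists_inP //|none] := boolP [exists k in S, X (colour_class k)].
exfalso.
have nX k : k \in S -> ~~ X (colour_class k).
  by move=> kS; apply: contraNN none => Xk; apply/exists_inP; exists k.
have [f Hf] : exists f : C -> option V, forall k, k \in S ->
    exists2 x, f k = Some x & col x = k.
  exists (fun k => [pick x in colour_class k]) => k /classS/set0Pn[x xk].
  case: pickP => [y|/(_ x)]; last by rewrite xk.
  by rewrite inE => /eqP; exists y.
(* Singletons belong to X, being contained in rainbow sets; so a class outside X
   has at least two elements, as the elimination of its colour requires. *)
have X1 k x : k \in S -> col x = k -> X [set x].
  move=> kS xk.
  pose R := x |: [set y | (Some y == f (col y)) && (col y \in S :\ k)].
  apply: (Xdown R); first by rewrite sub1set setU11.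
  apply: rainbowX; apply/rainbowP; split.
    by apply/colouredP=> y /setU1P[->|]; rewrite ?xk // !inE => /and3P[].
  move=> j jS; rewrite multU1 !inE xk eqxx andbF /=.
  have [<-|kj] := eqVneq k j; rewrite /mult.
    rewrite (_ : _ :&: _ = set0) ?cards0 //; apply/setP=> y; rewrite !inE.
    by case: eqP => //= _; case: eqP => //; rewrite andbF.
  have [y fy yj] := Hf j jS.
  rewrite (_ : _ :&: _ = [set y]) ?cards1 //; apply/setP=> v; rewrite !inE.
  have [vj|vj] := eqVneq (col v) j.
    by rewrite vj fy jS [j == k]eq_sym kj !andbT.
  by rewrite andbF; apply/esym/eqP=> vy; rewrite vy yj eqxx in vj.
have class2 : {in S, forall k, 1 < #|colour_class k|}%N.
  move=> k kS; rewrite ltn_neqAle eq_sym card_gt0 classS // andbT.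
  apply: contra (nX k kS) => /cards1P[x kx]; rewrite kx; apply: (X1 k) => //.
  by apply/eqP; rewrite -in_class kx set11.
have [c sysc] := system_exists fillX rainbowX.
move: (erefl #|S|) c sysc nX class2 {fillX rainbowX classS X1 Hf none}.
elim: {S}#|S| {-2}S => [|n IH] S.
  by move/cards0_eq=> -> c /no_system0.
move=> Sn c sysc nX class2.
have [k kS] : exists k, k \in S by apply/set0Pn; rewrite -card_gt0 Sn.
have [w sysw] := system_eliminate kS Xdown (nX k kS) (class2 k kS) sysc.
apply: (IH _ _ w sysw).
- by move: Sn; rewrite (cardsD1 k) kS => -[].
- by move=> j /setD1P[_ /nX].
- by move=> j /setD1P[_ /class2].
Qed.

End Colours.

(** * The colourful Caratheodory theorem *)

Lemma conv_feasible (V : finType) (O : orientedMatroid (option V))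
    (A : {set V}) :
  (None \in conv O [set Some u | u in A]) = ~~ feasible O A.
Proof.
have NA : None \notin [set Some u | u in A] by apply/imsetP=> -[].
rewrite !inE (negPf NA) /=; apply/idP/idP.
  case/exists_inP=> Phi /[!inE] /forall_inP PhiL /andP[/subsetP PhiP /eqP PhiN].
  apply/feasibleP=> -[Psi OPsi [PsiN PsiA]].
  have PhiNone : Phi None = Neg.
    by apply/eqP; have := set11 (None : option V); rewrite -PhiN inE.
  have := PhiL Psi OPsi; rewrite sv_orthogonalE.
  have -> : opposes Phi Psi.
    by apply/existsP; exists None; rewrite PhiNone PsiN.
  rewrite eqb_id => /existsP[e /andP[/eqP eE Pe]].
  have [eP|eP] := eqVneq (Phi e) Pos.
    have : e \in [set Some u | u in A] by apply: PhiP; rewrite inE eP.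
    by case/imsetP=> u /PsiA + ue; rewrite -ue -eE eP.
  have : e \in sv_neg Phi by rewrite inE; case: (Phi e) Pe eP.
  by rewrite PhiN inE => /eqP e0; rewrite e0 PhiNone PsiN in eE.
move=> nfeas.
have [[Psi OPsi [PsiN PsiA]]|[Phi OPhi [PhiN PhiA Phi0]]] := farkas O NA.
  case/negP: nfeas; apply/feasibleP; exists Psi => //; split=> // u uA.
  by apply: PsiA; apply: imset_f.
apply/exists_inP; exists Phi => //; apply/andP; split.
  apply/subsetP=> e; rewrite inE => /eqP eP.
  have : e \in None |: [set Some u | u in A].
    by apply: contraTT isT => /Phi0; rewrite eP.
  by case/setU1P=> // e0; rewrite e0 PhiN in eP.
apply/eqP/setP=> e; rewrite !inE; have [->|e0] := eqVneq e None.
  by rewrite PhiN.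
have [eA|eA] := boolP (e \in [set Some u | u in A]).
  by apply/negbTE/PhiA.
by rewrite Phi0 // !inE negb_or e0.
Qed.

(* The ground set V + {v0} is [option V], with v0 = [None]. *)
Theorem theorem1p9 (V : finType) (d : nat) (O : orientedMatroid (option V))
    (rankO : om_rank O <= d) (r : nat) (le_dr : d <= r)
    (U : 'I_r -> {set V})
    (disjU : forall i j : 'I_r, i != j -> [disjoint U i & U j])
    (neU : forall i : 'I_r, U i != set0)
    (convU : forall i : 'I_r, None \in conv O [set Some u | u in U i]) :
  exists u : 'I_r -> V,
    (forall i : 'I_r, u i \in U i) /\
    None \in conv O [set Some (u i) | i : 'I_r].
Proof.
(* Elements outside all the U i receive the colour None, which is not in S. *)
pose col x : option 'I_r := [pick i | x \in U i].
pose S := [set Some i | i : 'I_r].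
have colE x i : (col x == Some i) = (x \in U i).
  rewrite /col; case: pickP => [j xj|->//].
  have [<-|ji] := eqVneq j i; first by rewrite eqxx.
  rewrite (disjointFr (disjU j i ji) xj).
  by apply/eqP=> -[/eqP]; rewrite (negPf ji).
have classE i : colour_class col (Some i) = U i.
  by apply/setP=> x; rewrite inE colE.
have [/existsP[u /andP[/forallP uU uconv]]|none] :=
  boolP [exists u : {ffun 'I_r -> V}, [forall i, u i \in U i] &&
    (None \in conv O [set Some (u i) | i : 'I_r])]; first by exists u.
have [||||k] := @colourful_simplex V _ col (feasible O) S.
- by move=> sigma tau; apply: feasible_sub.
- move=> A m; rewrite card_imset ?card_ord; last by move=> i j [].
  move=> rm; apply: feasible_fillable.
  exact: leq_trans rankO (leq_trans le_dr rm).
- move=> R /rainbowP[/colouredP RS R1].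
  have /fin_all_exists[u Hu] i : exists u, (R :&: U i) = [set u].
    by apply/cards1P; rewrite -classE; apply/eqP/R1/imset_f.
  have uU i : u i \in R :&: U i by rewrite Hu set11.
  move: none; rewrite negb_exists => /forallP/(_ [ffun i => u i]).
  rewrite negb_and => /orP[/forallPn[i]|].
    by rewrite ffunE; have /setIP[_ ->] := uU i.
  have -> : [set Some ([ffun i => u i] i) | i : 'I_r] = [set Some x | x in R].
    apply/setP=> e; apply/imsetP/imsetP=> [[i _ ->]|[x xR ->]].
      by rewrite ffunE; exists (u i) => //; have /setIP[] := uU i.
    have /imsetP[i _ /eqP] := RS x xR; rewrite colE => xi.
    exists i => //; rewrite ffunE; congr Some; apply/eqP.
    by rewrite -in_set1 -Hu inE xR.
  by rewrite conv_feasible negbK.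
- by move=> k /imsetP[i _ ->]; rewrite classE.
case/imsetP=> i _ ->; rewrite classE => feas.
by have := convU i; rewrite conv_feasible feas.
Qed.
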